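(* Let $n\ge 3$ and $k\ge 3$. There exists a cyclic sequence over $\{0,\dots,k-1\}$ of length $L_k(n)=|\mathbf{S}_k(n)|$ whose length-$n$ windows are exactly the elements of $\mathbf{S}_k(n)$, each occurring exactly once (a universal cycle for $\mathbf{S}_k(n)$); this sequence is an orientable sequence of order $n$.
   Context: Let $\Sigma=\{0,1,\dots,k-1\}$. Strings are compared lexicographically ($\alpha<\beta$ if $\alpha$ is a proper prefix of $\beta$, or $\alpha$ has the smaller symbol at the first index where they differ). For $\alpha=a_1\cdots a_n$, $\alpha^R=a_n\cdots a_1$; $[\alpha]$ is the set of rotations of $\alpha$. $\alpha$ is a necklace if it is the lexicographically smallest element of $[\alpha]$; a bracelet if it is the lexicographically smallest element of $[\alpha]\cup[\alpha^R]$. A necklace $\alpha$ is symmetric if $\alpha^R\in[\alpha]$, asymmetric otherwise. $\mathbf{A}_k(n)$ is the set of asymmetric bracelets of length $n$ over $\Sigma$, and $\mathbf{S}_k(n)=\bigcup_{\alpha\in\mathbf{A}_k(n)}[\alpha]$. A cyclic sequence $s_1\cdots s_L$ has windows $w_t=s_t\cdots s_{t+n-1}$ ($t=1,\dots,L$, indices mod $L$); it is an orientable sequence of order $n$ if the $2L$ strings $w_1,\dots,w_L,w_1^R,\dots,w_L^R$ are pairwise distinct. *)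

(* Defs.v *)
From mathcomp Require Import all_boot.
Set Implicit Arguments. Unset Strict Implicit. Unset Printing Implicit Defensive.

(* Strings over Sigma = {0,...,k-1} are represented as [seq nat] whose
   entries are all < k. *)

Fixpoint lexle (a b : seq nat) : bool :=
  match a, b with
  | [::], _ => true
  | _ :: _, [::] => false
  | x :: a', y :: b' => (x < y) || ((x == y) && lexle a' b')
  end.

Definition rotations (a : seq nat) : seq (seq nat) :=
  [seq rot i a | i <- iota 0 (size a)].

Definition is_necklace (a : seq nat) : bool :=
  all (lexle a) (rotations a).

Definition is_bracelet (a : seq nat) : bool :=
  all (lexle a) (rotations a ++ rotations (rev a)).

Definition is_symmetric (a : seq nat) : bool := rev a \in rotations a.

Fixpoint all_strings (k n : nat) : seq (seq nat) :=
  match n with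
  | 0 => [:: [::]]
  | n'.+1 => [seq x :: w | x <- iota 0 k, w <- all_strings k n']
  end.

Definition in_A (k n : nat) (a : seq nat) : bool :=
  [&& size a == n, all (fun x => x < k) a, is_necklace a, is_bracelet a
    & ~~ is_symmetric a].

Definition S_list (k n : nat) : seq (seq nat) :=
  [seq w <- all_strings k n |
     has (fun a => in_A k n a && (w \in rotations a)) (all_strings k n)].

Definition L (k n : nat) : nat := size (S_list k n).

Definition window (n : nat) (s : seq nat) (t : nat) : seq nat :=
  [seq nth 0 s ((t + j) %% size s) | j <- iota 0 n].

Definition windows (n : nat) (s : seq nat) : seq (seq nat) :=
  [seq window n s t | t <- iota 0 (size s)].

Definition orientable (n : nat) (s : seq nat) : bool :=
  uniq (windows n s ++ map rev (windows n s)).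

(* Main.v *)
Require Import Defs.
From mathcomp Require Import all_boot all_fingroup zify.

(** The rotation classes in [S_list k n] are joined into one cycle whenever they
    are connected by changing one symbol: an overlap-respecting permutation of
    [S_list k n] composed with the transposition of [x :: w] and [y :: w] still
    respects overlaps, and joins the orbits of the two words.

    Connectivity: put [m := k - 1]. The first symbol of an asymmetric bracelet can
    be lowered to [0]. Then write it as [u ++ s :: m^c] with [s < m]. Raising [s] to
    [m - 1], or from [m - 1] to [m], gives an asymmetric bracelet again, unless
    [s = m - 1] and [u = p ++ m^j] with [p] a palindrome and [j < c]. In the latter
    case the final [0] of [p] can be raised to [1], if [p] is not just [0]. As the
    sum of the symbols grows, this ends with [0 m^j (m-1) m^c], which is two
    changes away from [0 (m-1) m^(n-2)]. *)

Set Implicit Arguments. Unset Strict Implicit. Unset Printing Implicit Defensive.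

(** * Asymmetric bracelets *)

Definition lexlt (a b : seq nat) : bool := ~~ lexle b a.

Lemma lexlexx a : lexle a a.
Proof. by elim: a => //= x a ->; rewrite eqxx orbT. Qed.

Lemma lexltxx a : lexlt a a = false.
Proof. by rewrite /lexlt lexlexx. Qed.

Lemma lexle_anti a b : lexle a b -> lexle b a -> a = b.
Proof.
elim: a b => [|x a IH] [|y b] //=; case: ltngtP => //= -> hab hba.
by rewrite (IH b).
Qed.

Lemma lexlt_cons x a y b :
  lexlt (x :: a) (y :: b) = (x < y) || ((x == y) && lexlt a b).
Proof. by rewrite /lexlt /= negb_or negb_and (eq_sym y); case: ltngtP. Qed.

Lemma lexlt_cat a b c d : size a = size b ->
  lexlt (a ++ c) (b ++ d) = lexlt a b || ((a == b) && lexlt c d).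
Proof.
elim: a b => [|x a IH] [|y b] //= [hs]; rewrite !lexlt_cons IH // eqseq_cons.
by case: ltngtP.
Qed.

Lemma lexle_cat a b c d : size a = size b ->
  lexle (a ++ c) (b ++ d) = lexlt a b || ((a == b) && lexle c d).
Proof.
elim: a b => [|x a IH] [|y b] //= [hs]; rewrite IH // lexlt_cons eqseq_cons.
by case: ltngtP.
Qed.

Lemma lexlt_cat2l a b c : lexlt (a ++ b) (a ++ c) = lexlt b c.
Proof. by rewrite lexlt_cat // lexltxx eqxx. Qed.

Lemma lexlt_cat2r a b c : size a = size b -> lexlt (a ++ c) (b ++ c) = lexlt a b.
Proof. by move=> hs; rewrite lexlt_cat // lexltxx andbF orbF. Qed.

(** Cuts [p ++ q] replace rotation indices, so that concatenation lemmas apply. As [rev p ++ rev q]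
    runs through the rotations of [rev a], strictness in the second clause encodes bracelet and
    asymmetry at once. *)
Definition asym_bracelet (a : seq nat) : Prop :=
  (forall p q, a = p ++ q -> lexle a (q ++ p)) /\
  (forall p q, a = p ++ q -> lexlt a (rev p ++ rev q)).

Lemma mem_rotations w a : 0 < size a ->
  reflect (exists i, w = rot i a) (w \in rotations a).
Proof.
move=> ha; apply: (iffP mapP) => [[i _ ->]|[i ->]]; first by exists i.
case: (ltnP i (size a)) => hi; first by exists i; rewrite // mem_iota.
by exists 0; rewrite ?mem_iota // rot0 rot_oversize.
Qed.

Lemma mem_rotations_cat a w : 0 < size a ->
  reflect (exists p q, a = p ++ q /\ w = q ++ p) (w \in rotations a).
Proof.
move=> ha; apply: (iffP (mem_rotations w ha)) => [[i ->]|[p [q [-> ->]]]].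
  by exists (take i a), (drop i a); rewrite cat_take_drop.
by exists (size p); rewrite rot_size_cat.
Qed.

Lemma lexltW a b : lexlt a b -> lexle a b.
Proof.
by elim: a b => [|x a IH] [|y b] //; rewrite lexlt_cons /=; case: ltngtP => //= _ /IH.
Qed.

Lemma asym_bracelet_rot_rev a i : asym_bracelet a -> lexlt a (rot i (rev a)).
Proof.
case=> _ hR; rewrite -rev_rotr /rotr /rot rev_cat; apply: hR.
by rewrite cat_take_drop.
Qed.

Lemma in_AP k n a : 0 < n ->
  reflect [/\ size a = n, all (fun x => x < k) a & asym_bracelet a] (in_A k n a).
Proof.
move=> hn; apply: (iffP and5P) => [[/eqP hs hk hN hB hS]|[hs hk [hN hR]]].
  have ha : 0 < size a by rewrite hs.
  have hra : 0 < size (rev a) by rewrite size_rev.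
  split=> //; split=> p q e.
    by apply: (allP hN); apply/mem_rotations_cat => //; exists p, q.
  have le : lexle a (rev p ++ rev q).
    apply: (allP hB); rewrite mem_cat; apply/orP; right.
    by apply/mem_rotations_cat => //; exists (rev q), (rev p); rewrite e rev_cat.
  apply/negP => ge; move/negP: hS; apply.
  apply/mem_rotations_cat => //; exists p, q; split=> //.
  by rewrite (lexle_anti le ge) rev_cat !revK.
have ha : 0 < size a by rewrite hs.
have hra : 0 < size (rev a) by rewrite size_rev.
have N w : w \in rotations a -> lexle a w.
  by case/(mem_rotations_cat _ ha)=> p [q [e ->]]; apply: hN.
have Rv w : w \in rotations (rev a) -> lexlt a w.
  case/(mem_rotations_cat _ hra)=> p [q [e ->]].
  rewrite -[p]revK -[q]revK; apply: hR.
  by rewrite -rev_cat -e revK.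
split; first exact/eqP.
- by [].
- by apply/allP => w /N.
- apply/allP => w; rewrite mem_cat => /orP[/N//|/Rv].
  exact: lexltW.
- apply/negP => /(mem_rotations_cat _ ha)[p [q [e1 e2]]].
  have := hR p q e1; rewrite -rev_cat -e2 revK.
  by rewrite lexltxx.
Qed.

(** * The word set: rotations and reversals *)

Lemma all_stringsP k n w :
  (w \in all_strings k n) = (size w == n) && all (fun x => x < k) w.
Proof.
elim: n w => [|n IH] [|x w] /=; rewrite ?inE //.
  by apply/allpairsPdep => -[y [v [_ _]]].
apply/allpairsPdep/idP => [[y [v [hy hv [-> ->]]]]|/and3P[hs hx hw]].
  by move: hv hy; rewrite IH mem_iota /= eqSS => /andP[-> ->] ->.
exists x, w; split=> //; first by rewrite mem_iota.
by rewrite IH -eqSS hs.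
Qed.

Lemma all_strings_uniq k n : uniq (all_strings k n).
Proof.
elim: n => //= n IH; apply: allpairs_uniq; rewrite ?iota_uniq //.
by move=> [x v] [y w] _ _ /= [-> ->].
Qed.

Lemma S_listP k n w : 0 < n ->
  reflect (exists a, in_A k n a /\ w \in rotations a) (w \in S_list k n).
Proof.
move=> hn; rewrite mem_filter.
apply: (iffP andP) => [[/hasP[a _ /andP[ha hw]] _]|[a [ha hw]]].
  by exists a.
have [hs hk _] := in_AP k a hn ha; split.
  by apply/hasP; exists a; rewrite ?ha ?hw // all_stringsP hs eqxx.
case/mapP: hw => i _ ->.
by rewrite all_stringsP size_rot hs eqxx (eq_all_r (mem_rot i a)).
Qed.

Lemma S_list_rot k n i w : 0 < n -> (rot i w \in S_list k n) = (w \in S_list k n).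
Proof.
move=> hn.
have imp j v : v \in S_list k n -> rot j v \in S_list k n.
  case/(S_listP _ _ hn) => a [hA hv]; apply/S_listP => //; exists a; split=> //.
  have [hs _ _] := in_AP k a hn hA.
  have ha : 0 < size a by rewrite hs.
  case/(mem_rotations _ ha): hv => i' ->; apply/mem_rotations => //.
  by rewrite rot_rot_add; eexists.
apply/idP/idP; last exact: imp.
by move=> h; rewrite -(rotK i w) /rotr; apply: imp.
Qed.

Lemma in_A_S_list k n a : 0 < n -> in_A k n a -> a \in S_list k n.
Proof.
move=> hn hA; apply/S_listP => //; exists a; split=> //.
have [hs _ _] := in_AP k a hn hA.
by apply/mem_rotations; [rewrite hs|exists 0; rewrite rot0].
Qed.

(** Otherwise the representatives [a] of [w] and [b] of [rev w] would be rotations of each other's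
    reversals, giving both [lexlt a b] and [lexlt b a]. This is the source of orientability. *)
Lemma rev_notin_S_list k n w : 0 < n -> w \in S_list k n -> rev w \notin S_list k n.
Proof.
move=> hn /(S_listP _ _ hn)[a [hA hw]]; apply/negP => /(S_listP _ _ hn)[b [hB hv]].
have [sa _ Ga] := in_AP k a hn hA; have [sb _ Gb] := in_AP k b hn hB.
have ha : 0 < size a by rewrite sa.
have hb : 0 < size b by rewrite sb.
case/(mem_rotations _ ha): hw => i ew; case/(mem_rotations _ hb): hv => j ev.
have rot_rev (c d : seq nat) i' j' : rev (rot i' c) = rot j' d -> exists m, d = rot m (rev c).
  by move=> e; rewrite -(rotK j' d) -e rev_rot /rotr rot_rot_add; eexists.
have [m eb] : exists m, b = rot m (rev a) by apply: (rot_rev a b i j); rewrite -ew.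
have [m' ea] : exists m, a = rot m (rev b) by apply: (rot_rev b a j i); rewrite -ev revK.
have := asym_bracelet_rot_rev m Ga; rewrite -eb => /lexltW le.
by have := asym_bracelet_rot_rev m' Gb; rewrite -ea /lexlt le.
Qed.

(** * Cycle joining *)

Section CycleJoining.

Variables (n : nat) (V : seq (seq nat)) (r : seq nat).
Hypotheses (n_gt0 : 0 < n) (V_uniq : uniq V) (V_size : {in V, forall w, size w = n}).
Hypothesis (V_rot : forall w, w \in V -> rot 1 w \in V).
Hypothesis (r_in : r \in V).
(** Connectivity takes the form of an induction principle, to be applied to the predicate of lying
    in the orbit of [r]. *)
Hypothesis V_connected : forall C : seq nat -> Prop, C r ->
  (forall w, w \in V -> C w <-> C (rot 1 w)) ->
  (forall x y w, x :: w \in V -> y :: w \in V -> C (x :: w) -> C (y :: w)) ->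
  {in V, forall w, C w}.

Local Notation T := (seq_sub V).

(** Such an [f] is a successor map: each of its orbits spells a cyclic sequence whose windows are
    the words of the orbit. *)
Definition overlap (f : {perm T}) : bool :=
  [forall x : T, behead (val x) == take n.-1 (val (f x))].

Lemma overlap_perm_exists : exists f, overlap f.
Proof.
pose g (x : T) : T := insubd x (rot 1 (val x)).
have gE x : val (g x) = rot 1 (val x) by rewrite val_insubd V_rot // ssvalP.
have g_inj : injective g.
  by move=> x y /(congr1 val); rewrite !gE => /rot_inj /val_inj.
exists (perm g_inj); apply/forallP => x; rewrite permE gE.
have := V_size (ssvalP x); rewrite -[ssval x]/(val x).
case: (val x) => [|y w] /= hw; first by move: n_gt0; rewrite -hw.
by rewrite -hw rot1_cons -cats1 /= take_size_cat.
Qed.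

(* Composing with the transposition of two words with the same tail joins
   their orbits, so an overlap permutation with the fewest orbits has one. *)
Lemma overlap_cycle_exists (r' : T) : val r' = r ->
  exists2 f, overlap f & forall x, x \in porbit f r'.
Proof.
move=> er; have [f0 hf0] := overlap_perm_exists.
case: (@arg_minnP _ f0 overlap (fun f => #|porbits f|) hf0) => f hf fmin.
exists f => //.
have same_tail (x y : T) : behead (val x) = behead (val y) -> x \in porbit f y.
  move=> exy; apply/negPn/negP => nxy.
  have hx : x != y by apply: contraNneq nxy => ->; apply: porbit_id.
  have ht : overlap (tperm x y * f)%g.
    apply/forallP => z; rewrite permM -(eqP (forallP hf _)).
    by case: tpermP => [->|->|] //; rewrite exy.
  have := fmin _ ht; have := porbits_mul_tperm f x y; rewrite /= nxy hx.
  by rewrite addn1 addn2 => -[<-]; rewrite ltnn.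
pose C w := exists2 x : T, val x = w & x \in porbit f r'.
have inC (x : T) : C (val x) -> x \in porbit f r' by case=> y /val_inj ->.
have CV : {in V, forall w, C w}.
  apply: V_connected; first by exists r'; rewrite ?porbit_id.
  - move=> w hw; pose x : T := SeqSub hw; pose z : T := SeqSub (V_rot hw).
    have xz : porbit f x = porbit f z.
      (* [f] need not send [x] to its rotation [z], but the preimage [y] of [z] has the same tail as
         [x], so [same_tail] applies. *)
      pose y := (f^-1)%g z.
      have fy : f y = z by rewrite permKV.
      have -> : porbit f z = porbit f y by rewrite -fy -{2}[f]expg1 porbit_perm.
      apply/eqP; rewrite eq_porbit_mem; apply: same_tail.
      rewrite (eqP (forallP hf y)) fy /=.
      have := V_size hw; case: (w) => [|a v] /= hv; first by move: n_gt0; rewrite -hv.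
      by rewrite -hv rot1_cons -cats1 /= take_size_cat.
    split=> [/(inC x)|/(inC z)]; rewrite -eq_porbit_mem.
      by rewrite xz eq_porbit_mem; exists z.
    by rewrite -xz eq_porbit_mem; exists x.
  - move=> a b w ha hb /(inC (SeqSub ha)) hC; exists (SeqSub hb) => //.
    move: hC; rewrite -!eq_porbit_mem => /eqP <-; rewrite eq_porbit_mem.
    exact: same_tail.
by move=> x; apply: inC; apply: CV; apply: ssvalP.
Qed.

(** The cycle lists the first symbols along the single orbit. The last conclusion keeps its symbols
    in the alphabet of [V]. *)
Lemma universal_cycle_exists : exists s,
  [/\ size s = size V, perm_eq (windows n s) V &
      {subset s <= [seq head 0 w | w <- V]}].
Proof.
pose r' : T := SeqSub r_in.
have [f hf fT] := overlap_cycle_exists (erefl : val r' = r).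
set N := #|porbit f r'|.
have hN : N = size V by rewrite -(card_seq_sub V_uniq); apply: eq_card => x; rewrite fT.
have N_gt0 : 0 < N by rewrite lt0n card_porbit_neq0.
have iterN i : iter (i %% N) f r' = iter i f r'.
  rewrite {2}(divn_eq i N) addnC iterD; congr iter.
  have iN : iter N f r' = r' by apply: iter_porbit.
  elim: (i %/ N) => // m IH; rewrite mulSn addnC iterD iN; exact: IH.
have sizeT (x : T) : size (val x) = n by apply/V_size/ssvalP.
(* Each application of [f] drops one leading symbol, so the heads of [n] successive words spell the
   first of them. *)
have nthf j (x : T) : j < n -> head 0 (val (iter j f x)) = nth 0 (val x) j.
  elim: j x => [|j IH] x hj; first by rewrite nth0.
  rewrite iterSr IH 1?ltnW // -nth_behead (eqP (forallP hf x)) nth_take //.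
  by lia.
pose s := [seq head 0 (val (iter i f r')) | i <- iota 0 N].
have ss : size s = N by rewrite size_map size_iota.
have ws : windows n s = map val (traject f r' N).
  apply: (@eq_from_nth _ [::]); first by rewrite [LHS]size_map size_iota ss size_map size_traject.
  move=> t; rewrite size_map size_iota ss => ht.
  rewrite /windows (nth_map 0) ?size_iota ?ss // nth_iota // add0n.
  rewrite (nth_map r') ?size_traject // nth_traject //.
  apply: (@eq_from_nth _ 0).
    by rewrite size_map size_iota sizeT.
  move=> j; rewrite size_map size_iota => hj.
  rewrite (nth_map 0) ?size_iota // nth_iota // add0n ss.
  have hm : (t + j) %% N < N by rewrite ltn_mod.
  rewrite (nth_map 0) ?size_iota // nth_iota // add0n iterN addnC iterD.
  exact: nthf.
exists s; split; first by rewrite ss.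
  rewrite ws; apply: uniq_perm => //.
    by rewrite map_inj_uniq ?uniq_traject_porbit //; apply: val_inj.
  move=> w; apply/mapP/idP => [[x _ ->]|hw]; first exact: ssvalP.
  by exists (SeqSub hw) => //; rewrite -porbit_traject.
move=> y /mapP[i _ ->]; apply/mapP; exists (val (iter i f r')) => //.
exact: ssvalP.
Qed.

End CycleJoining.

(** * Connectivity *)

Lemma cat_eq_cat_le (a b c d : seq nat) : a ++ b = c ++ d -> size c <= size a ->
  exists2 e, a = c ++ e & d = e ++ b.
Proof.
elim: c a => [|x c IH] [|y a] //=; first by move=> ->; exists [::].
  by move=> <- _; exists (y :: a).
by move=> [-> /IH] h /h [e -> ->]; exists e.
Qed.

Lemma split_nseq (m : nat) (u : seq nat) : all (fun x => x <= m) u ->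
  exists j t, u = nseq j m ++ t /\ (t = [::] \/ exists h t', t = h :: t' /\ h < m).
Proof.
elim: u => [|x u IH] /=; first by exists 0, [::]; split; [|left].
case/andP => hx /IH[j [t [-> ht]]].
case: (ltnP x m) => hxm; last first.
  by exists j.+1, t; split=> //=; congr cons; lia.
by exists 0, (x :: nseq j m ++ t); split=> //; right; exists x, (nseq j m ++ t).
Qed.

Lemma lexlt_nseq_head j c (m h : nat) t w : j < c -> h < m ->
  lexlt (nseq j m ++ h :: t) (nseq c m ++ w).
Proof.
move=> hj hh; rewrite -(subnKC hj) addSnnS nseqD -catA lexlt_cat2l.
by rewrite /= lexlt_cons hh.
Qed.

(** * Raising one symbol of an asymmetric bracelet *)

(** A cut after the changed symbol yields a word with positive first symbol, which is larger. For a
    cut [p ++ w] of [0 :: u], rotations stay larger; reversals are decided by [p] against [rev p],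
    unless [p] is a palindrome. That case is left as a hypothesis. *)
Lemma asym_bracelet_raise u s s' v :
  all (fun x => 0 < x) v -> s < s' -> asym_bracelet (0 :: u ++ s :: v) ->
  (forall p w, 0 :: u = p ++ w -> p = rev p -> p != [::] ->
     lexlt (w ++ s :: v) (rev v ++ s :: rev w) ->
     lexlt (w ++ s' :: v) (rev v ++ s' :: rev w)) ->
  asym_bracelet (0 :: u ++ s' :: v).
Proof.
move=> v_gt0 ss' [hN hR] hp.
have s'_gt0 : 0 < s' by lia.
split=> p q; rewrite -!cat_cons => e.
  case: (leqP (size p) (size (0 :: u))) => hs.
    have [w ew eq] := cat_eq_cat_le e hs.
    have := hN p (w ++ s :: v); rewrite -!cat_cons ew catA => /(_ erefl).
    rewrite eq.
    have hw : size w <= size (p ++ w) by rewrite size_cat leq_addl.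
    (* The first [size w] symbols on both sides are unchanged. After a tie there, the symbol [h] of
       the word faces [s] in the old rotation and [s'] in the new one, and [h <= s < s']. *)
    rewrite -(cat_take_drop (size w) (p ++ w)) -!catA.
    have hsz : size (take (size w) (p ++ w)) = size w by rewrite size_takel.
    rewrite !(lexle_cat _ _ hsz) => /orP[->//|/andP[->]].
    have : size (drop (size w) (p ++ w)) = size p by rewrite size_drop size_cat addnK.
    case: (drop _ _) => [|h t] /=; first by move=> /esym /size0nil -> _; rewrite cats0 lexlexx eqxx !orbT.
    move=> _ h1; have hh : h <= s by case: ltngtP h1.
    by rewrite (leq_ltn_trans hh ss') !orbT.
  have [w ew eq] := cat_eq_cat_le (esym e) (ltnW hs).
  case: q eq e => [|x q] eq e; first by rewrite e cats0 lexlexx.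
  case: w ew eq => [|y w] ew [_ eq]; first by move: hs; rewrite ew cats0 ltnn.
  have hx : 0 < x by apply: (allP v_gt0); rewrite eq mem_cat in_cons eqxx orbT.
  by rewrite /= hx.
case: (leqP (size p) (size (0 :: u))) => hs.
  have [w ew eq] := cat_eq_cat_le e hs.
  case: (altP (p =P [::])) => [ep|pn].
    rewrite {}eq {}ep /= in e ew *; rewrite -ew rev_cat rev_cons.
    have : all (fun x => 0 < x) (s' :: v) by rewrite /= s'_gt0.
    rewrite -all_rev rev_cons; case: (rev v) => [|x t] /=.
      by rewrite lexlt_cons s'_gt0.
    by case/andP=> hx _; rewrite lexlt_cons hx.
  have := hR p (w ++ s :: v); rewrite -cat_cons ew catA => /(_ erefl).
  rewrite eq -!catA !lexlt_cat ?size_rev // => /orP[->//|/andP[/eqP epr h]].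
  rewrite -epr eqxx /=.
  move: h; rewrite !rev_cat !rev_cons !cat_rcons => h.
  by rewrite (hp p w) ?orbT.
have [w ew eq] := cat_eq_cat_le (esym e) (ltnW hs).
case/lastP: w ew eq => [|w x] ew eq; first by move: hs; rewrite ew cats0 ltnn.
have hx : 0 < x.
  have : all (fun x => 0 < x) (s' :: v) by rewrite /= s'_gt0.
  by rewrite eq all_cat all_rcons -andbA => /and3P[].
by rewrite ew rev_cat rev_rcons /= lexlt_cons hx.
Qed.

(** With a single [0], every other reading of the cycle starts with a positive symbol, except the
    reversed one [0 :: rev w]. *)
Lemma asym_bracelet_zero w :
  all (fun x => 0 < x) w -> lexlt w (rev w) -> asym_bracelet (0 :: w).
Proof.
move=> w_gt0 lt; split=> -[|x p] q e.
- by rewrite e cats0 lexlexx.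
- case: q e => [|y q] [<- e]; first by rewrite e cats0 lexlexx.
  have hy : 0 < y by apply: (allP w_gt0); rewrite e mem_cat in_cons eqxx orbT.
  by rewrite /= hy.
- move: e; rewrite cat0s => <-; have [y [t ew]] : exists y t, w = rcons t y.
    by case/lastP: w lt {w_gt0} => // t y _; exists y, t.
  move: w_gt0; rewrite ew all_rcons => /andP[hy _].
  by rewrite -rcons_cons rev_rcons /= lexlt_cons hy.
case: e => <- e; case/lastP: p e => [|p y] e.
  by rewrite e in lt *; rewrite /= lexlt_cons lt orbT.
have hy : 0 < y by apply: (allP w_gt0); rewrite e mem_cat mem_rcons inE eqxx.
by rewrite -rcons_cons rev_rcons /= lexlt_cons hy.
Qed.

(** Minimality among rotations makes all symbols at least [h], and the reversed reading from [h]
    gives [lexlt w (rev w)]. *)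
Lemma asym_bracelet_first_zero h w : 0 < h -> asym_bracelet (h :: w) ->
  asym_bracelet (0 :: w).
Proof.
move=> h0 [hN hR]; apply: asym_bracelet_zero.
  apply/allP => x xw; case/splitPr: xw hN {hR} => p q hN.
  by have /= := hN (h :: p) (x :: q) erefl; case: ltngtP => //; lia.
have := hR [:: h] w erefl.
by rewrite /= lexlt_cons ltnn eqxx.
Qed.

Section Raise.

Variables (m : nat) (u : seq nat).
Hypothesis u_le : all (fun x => x <= m) u.

(** Let [j] be the length of the leading run of [m] in [w]. If [j < c], the symbol after the run
    decides; it is [s'] when [w] is nothing but the run, whence the hypothesis. If [j >= c], the
    blocks [nseq c m] cancel on both sides. *)
Lemma asym_bracelet_raise_last s s' c : s < s' -> s' <= m -> 0 < m ->
  (forall p j, 0 :: u = p ++ nseq j m -> p = rev p -> p != [::] ->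
     j < c -> s' < m) ->
  asym_bracelet (0 :: u ++ s :: nseq c m) ->
  asym_bracelet (0 :: u ++ s' :: nseq c m).
Proof.
move=> ss' s'm m0 hp ha; apply: asym_bracelet_raise ha _ => //.
  by rewrite all_nseq m0 orbT.
move=> p w e pr pn.
have w_le : all (fun x => x <= m) w.
  have : all (fun x => x <= m) (0 :: u) by rewrite /= u_le.
  by rewrite e all_cat => /andP[].
rewrite rev_nseq; have [j [t [ew ht]]] := split_nseq w_le.
case: (ltnP j c) => hj.
  move=> _; case: ht => [et|[h [t' [et hh]]]]; rewrite ew et.
    rewrite cats0; apply: lexlt_nseq_head => //.
    by apply: (hp p j) => //; rewrite e ew et cats0.
  by rewrite -catA; apply: lexlt_nseq_head.
have -> : w = nseq c m ++ (nseq (j - c) m ++ t) by rewrite catA -nseqD subnKC.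
move: (_ ++ t) => w' .
have tail x : lexlt (w' ++ x :: nseq c m) (x :: rev w' ++ nseq c m) =
    lexlt (rcons w' x) (x :: rev w').
  by rewrite -cat_rcons -cat_cons lexlt_cat2r //= size_rcons size_rev.
rewrite rev_cat rev_nseq -!catA !lexlt_cat2l !tail.
(* An empty [w'] would make the old strict comparison one between equal words. *)
case: w' {tail} => [|h w''] /=; first by rewrite lexltxx.
rewrite !lexlt_cons => h1; have hh : h <= s by case: ltngtP h1.
by rewrite (leq_ltn_trans hh ss').
Qed.

(* The critical comparison is the one for a palindromic prefix followed by
   [nseq c m]: reading the outer palindrome backwards, the word would then start
   with [0 :: nseq c m], although its rotation [0 :: nseq j m ++ s :: _] is smaller. *)
Lemma asym_bracelet_raise_palindrome j s c : s < m -> 1 < m -> 0 < s -> j < c ->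
  rcons (0 :: u) 0 = rev (rcons (0 :: u) 0) ->
  asym_bracelet (0 :: u ++ 0 :: nseq j m ++ s :: nseq c m) ->
  asym_bracelet (0 :: u ++ 1 :: nseq j m ++ s :: nseq c m).
Proof.
move=> sm m1 s0 jc pal ha; have [hN _] := ha.
apply: asym_bracelet_raise ha _ => //.
  by rewrite all_cat /= !all_nseq s0 (ltnW m1) !orbT.
move=> p w e pr pn.
have w_le : all (fun x => x <= m) w.
  have : all (fun x => x <= m) (0 :: u) by rewrite /= u_le.
  by rewrite e all_cat => /andP[].
rewrite rev_cat rev_cons !rev_nseq cat_rcons -!catA.
have [i [t [ew ht]]] := split_nseq w_le.
case: (ltnP i c) => hi.
  move=> _; case: ht => [et|[h [t' [et hh]]]]; rewrite ew et.
    by rewrite cats0; apply: lexlt_nseq_head.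
  by rewrite -catA; apply: lexlt_nseq_head.
have {t i ew ht hi} [w' ew] : exists w', w = nseq c m ++ w'.
  by exists (nseq (i - c) m ++ t); rewrite catA -nseqD subnKC.
rewrite ew -!catA !lexlt_cat2l rev_cat rev_nseq.
case: w' ew => [|h w'] ew /=.
  have := hN (0 :: u) (0 :: nseq j m ++ s :: nseq c m).
  rewrite cat_cons => /(_ erefl).
  have -> : 0 :: u ++ 0 :: nseq j m ++ s :: nseq c m =
     0 :: nseq c m ++ rev p ++ nseq j m ++ s :: nseq c m.
    rewrite -cat_cons -cat_rcons pal e ew cats0 -cats1 !rev_cat rev_nseq.
    by rewrite /= -!catA.
  rewrite /= -catA /= => le.
  have : lexlt (nseq j m ++ s :: (nseq c m ++ 0 :: u))
     (nseq c m ++ rev p ++ nseq j m ++ s :: nseq c m) by apply: lexlt_nseq_head.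
  by rewrite /lexlt -?catA /= -?catA le.
have hw' : all (fun x => x <= m) w' by move: w_le; rewrite ew all_cat /= => /and3P[].
rewrite !lexlt_cons; case: (ltngtP h s) => //= ehs.
rewrite rev_cons cat_rcons ehs.
(* Once [h = s], the run of [m] after it is compared with [nseq j m]. If that block cancels too, the
   raised symbol faces a symbol that the old comparison forces to be [0]. *)
have [i [t [ew' ht]]] := split_nseq hw'.
case: (ltnP i j) => hi.
  move=> _; case: ht => [et|[h' [t' [et hh]]]]; rewrite ew' et.
    by rewrite cats0; apply: lexlt_nseq_head.
  by rewrite -catA; apply: lexlt_nseq_head.
have -> : w' = nseq j m ++ (nseq (i - j) m ++ t) by rewrite catA -nseqD subnKC.
move: (_ ++ t) => g.
rewrite -!catA !lexlt_cat2l rev_cat rev_nseq -!catA.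
case: g => [|h' g] /=; first by rewrite lexltxx.
by rewrite !lexlt_cons; case: h'.
Qed.

End Raise.

(** * Reaching the root bracelet by single-symbol changes *)

Section Connectivity.

Variables (n m : nat).
Hypotheses (n_gt2 : 2 < n) (m_gt1 : 1 < m).

Local Notation A := (in_A m.+1 n).

Definition root_bracelet := 0 :: m.-1 :: nseq n.-2 m.

Let n_gt0 : 0 < n. Proof. exact: leq_ltn_trans n_gt2. Qed.

(** As [m > 1], the symbol [m.-1] is positive and the leading [0] unique; then [m.-1 < m]
    decides. *)
Lemma root_bracelet_in_A : A root_bracelet.
Proof.
apply/in_AP => //; split; rewrite /= ?size_nseq; first by lia.
  by rewrite all_nseq ltnSn orbT; lia.
apply: asym_bracelet_zero; first by rewrite /= all_nseq; lia.
rewrite rev_cons rev_nseq -[n]prednK // -[n.-1]prednK /=; last by lia.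
by rewrite -(@prednK n.-2) ?lexlt_cons; lia.
Qed.

Section Closure.

Variable C : seq nat -> Prop.
Hypothesis C_rot : forall w, w \in S_list m.+1 n -> C w <-> C (rot 1 w).
Hypothesis C_flip : forall x y w, x :: w \in S_list m.+1 n ->
  y :: w \in S_list m.+1 n -> C (x :: w) -> C (y :: w).

Lemma closure_rot i w : w \in S_list m.+1 n -> C w <-> C (rot i w).
Proof.
move=> hw; elim: i => [|i IH]; first by rewrite rot0.
case: (ltnP i (size w)) => hi; last by rewrite rot_oversize // ltnW.
by rewrite rotS //; apply: iff_trans IH _; apply: C_rot; rewrite S_list_rot.
Qed.

(** Rotating by [size p] brings the changed symbol to the front, where [C_flip] acts. *)
Lemma closure_change p x y q : A (p ++ x :: q) -> A (p ++ y :: q) ->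
  C (p ++ y :: q) -> C (p ++ x :: q).
Proof.
move=> /(in_A_S_list n_gt0) hx /(in_A_S_list n_gt0) hy.
rewrite (closure_rot (size p) hx) (closure_rot (size p) hy) !rot_size_cat.
have rotA z : (z :: q ++ p \in S_list m.+1 n) = (p ++ z :: q \in S_list m.+1 n).
  by rewrite -(S_list_rot _ (size p) (p ++ _) n_gt0) rot_size_cat.
by apply: C_flip; rewrite rotA.
Qed.

Lemma in_A_change p x y q : A (p ++ x :: q) -> y <= m ->
  asym_bracelet (p ++ y :: q) -> A (p ++ y :: q).
Proof.
case/(in_AP _ _ n_gt0) => hs hk _ hy ha; apply/in_AP => //; split=> //.
  by rewrite -hs !size_cat.
by move: hk; rewrite !all_cat /= !ltnS hy => /and3P[-> _ ->].
Qed.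

(** Termination measure: the total deficit from the constant word [m], so induction on it climbs to
    larger symbol sums. *)
Let codeg (a : seq nat) := sumn [seq m - x | x <- a].

Let codeg_raise p x y q : x < y -> y <= m ->
  codeg (p ++ y :: q) < codeg (p ++ x :: q).
Proof. by move=> hxy hy; rewrite /codeg !map_cat !sumn_cat /=; lia. Qed.

Lemma closure_zero w : C root_bracelet -> A (0 :: w) -> C (0 :: w).
Proof.
move=> Croot; have [N] := ubnP (codeg (0 :: w)).
elim: N w => // N IH w hN hA.
(* A raised word has smaller [codeg], so the induction hypothesis covers it and [closure_change]
   leads back. *)
have raise p x y q : w = p ++ x :: q -> x < y -> y <= m ->
    (asym_bracelet (0 :: p ++ x :: q) -> asym_bracelet (0 :: p ++ y :: q)) ->
    C (0 :: w).
  move=> ew xy ym hG; rewrite ew -cat_cons in hA hN *.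
  have [_ _ G] := in_AP _ _ n_gt0 hA.
  have hA' : A ((0 :: p) ++ y :: q) by apply: in_A_change hA ym (hG G).
  apply: (closure_change hA hA'); apply: IH hA'.
  exact: leq_trans (codeg_raise (0 :: p) q xy ym) hN.
have [hs hk G] := in_AP _ _ n_gt0 hA.
have w_le : all (fun x => x <= m) w by case/andP: hk => _; apply: sub_all => x; rewrite ltnS.
have [c [t [ew ht]]] : exists c t, rev w = nseq c m ++ t /\
    (t = [::] \/ exists h t', t = h :: t' /\ h < m).
  by apply: split_nseq; rewrite all_rev.
have {}ew : w = rev t ++ nseq c m by rewrite -(revK w) ew rev_cat rev_nseq.
(* If [w] consisted of [m] only, it would equal its reversal. *)
case: ht => [et|[s [t' [et hsm]]]].
  have := G.2 [:: 0] w erefl; rewrite ew et cat0s /= rev_nseq.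
  by rewrite lexltxx.
move: ew; rewrite et rev_cons cat_rcons; move: (rev t') => u {t' t et} ew.
have u_le : all (fun x => x <= m) u by move: w_le; rewrite ew all_cat => /andP[].
have m_gt0 : 0 < m by lia.
case: (ltnP s m.-1) => hs1.
  apply: (raise u s m.-1 (nseq c m)) => //; first by lia.
  by apply: asym_bracelet_raise_last => // [|p j _ _ _ _]; lia.
have es : s = m.-1 by lia.
(* A decidable form of the obstruction in [asym_bracelet_raise_last]; the range below covers every
   cut of [0 :: u], the full prefix included. *)
pose stuck i := let p := take i (0 :: u) in let q := drop i (0 :: u) in
  [&& p == rev p, p != [::], q == nseq (size q) m & size q < c].
case: (boolP (has stuck (iota 0 (size u).+2))) => [|free]; last first.
  apply: (raise u s m (nseq c m)) => //.
  apply: asym_bracelet_raise_last => // p j e pal pn jc.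
  case/negP: free; apply/hasP; exists (size p).
    by rewrite mem_iota /= add0n ltnS -[(size u).+1]/(size (0 :: u)) e size_cat leq_addr.
  by rewrite /stuck e take_size_cat // drop_size_cat // size_nseq -pal !eqxx pn.
case/hasP => i _ /and4P[].
have := cat_take_drop i (0 :: u); move: (take _ _) (drop _ _) => p q e.
move=> /eqP pal pn /eqP eq; move: (size q) eq => j eq jc; rewrite eq in e.
case: p pal pn e => // z p pal _ [ez eu]; rewrite ez in pal.
case/lastP: p pal eu => [|p y] pal eu.
  rewrite cat0s in eu.
  case: j eq jc eu => [|j] _ jc eu.
    suff <- : root_bracelet = 0 :: w by [].
    rewrite ew -eu es /root_bracelet; congr [:: _, _ & nseq _ _].
    by move: hs; rewrite ew -eu /= size_nseq; lia.
  (* The path lowers the first [m] to [s], then raises the later [s] to [m]. The intermediate word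
     has larger [codeg], so the induction hypothesis is not applied to it. *)
  have root_eq : root_bracelet = (0 :: s :: nseq j m) ++ m :: nseq c m.
    rewrite /root_bracelet /= es; congr [:: _, _ & _].
    rewrite -[m :: nseq c m]/(nseq c.+1 m) -nseqD; congr nseq.
    by move: hs; rewrite ew -eu /= size_cat /= !size_nseq; lia.
  have hA1 : A ([:: 0] ++ s :: nseq j m ++ s :: nseq c m).
    have hA0 : A ([:: 0] ++ m :: nseq j m ++ s :: nseq c m).
      by move: hA; rewrite ew -eu.
    apply: (in_A_change hA0) => //; first by lia.
    apply: asym_bracelet_zero => /=.
      by rewrite all_cat /= !all_nseq m_gt0 !orbT; lia.
    rewrite rev_cons rev_cat rev_cons !rev_nseq.
    by case: (c) jc => //= c' _; rewrite lexlt_cons hsm.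
  rewrite ew -eu; apply: (@closure_change [:: 0] m s) => //.
    by move: hA; rewrite ew -eu.
  apply: (@closure_change (0 :: s :: nseq j m) s m) => //; rewrite -root_eq //.
  exact: root_bracelet_in_A.
(* A palindrome of length at least two that starts with [0] also ends with [0]; that final [0] is
   raised to [1]. *)
have y0 : y = 0 by move: pal; rewrite -rcons_cons rev_rcons => -[].
rewrite y0 {y0 y} in pal eu.
apply: (raise p 0 1 (nseq j m ++ s :: nseq c m)) => //.
  by rewrite ew -eu cat_rcons -catA.
apply: asym_bracelet_raise_palindrome => //; last by lia.
by move: u_le; rewrite -eu all_cat all_rcons => /andP[/andP[]].
Qed.

Lemma closure_S_list : C root_bracelet -> {in S_list m.+1 n, forall w, C w}.
Proof.
move=> Croot w /(S_listP _ _ n_gt0)[a [hA hw]].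
have [hs _ G] := in_AP _ _ n_gt0 hA.
have ha : 0 < size a by rewrite hs.
case/(mem_rotations _ ha): hw => i ->.
apply/(closure_rot i (in_A_S_list n_gt0 hA)).
case: a hA G {hs ha} => [|[|h] v] hA G; [|exact: closure_zero|].
  by have := G.2 [::] [::] erefl.
have hA' : A ([::] ++ 0 :: v).
  by apply: (@in_A_change [::] h.+1) => //; apply: asym_bracelet_first_zero G.
by apply: (closure_change (p := [::]) hA hA'); apply: closure_zero.
Qed.

End Closure.
End Connectivity.

Theorem mainTheorem11 (n k : nat) (hn : 3 <= n) (hk : 3 <= k) :
  exists s : seq nat,
    [/\ all (fun x => x < k) s,
        size s = L k n,
        perm_eq (windows n s) (S_list k n)
      & orientable n s].
Proof.
have n_gt0 : 0 < n by lia.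
(* From here [m] is the largest symbol, and [hm] amounts to [1 < m]. *)
case: k hk => // m hm.
have S_word w : w \in S_list m.+1 n -> size w = n /\ all (fun x => x < m.+1) w.
  by rewrite mem_filter all_stringsP => /and3P[_ /eqP].
have S_uniq : uniq (S_list m.+1 n) by apply/filter_uniq/all_strings_uniq.
have [||||s [ss ws hs]] := @universal_cycle_exists n (S_list m.+1 n)
    (root_bracelet n m) n_gt0 S_uniq.
- by move=> w /S_word[].
- by move=> w; rewrite S_list_rot.
- exact/in_A_S_list/root_bracelet_in_A.
- by move=> C Croot Crot Cflip; apply: closure_S_list.
exists s; split=> //.
  apply/allP => x /hs /mapP[w /S_word[sw /allP hw] ->].
  by apply: hw; case: w sw => [|y w] /= sw; [lia|rewrite inE eqxx].
(* Windows are distinct because they enumerate [S_list], their reversals because [rev] is injective;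
   no reversal is a window since [S_list] contains no word together with its reversal. *)
rewrite /orientable cat_uniq (perm_uniq ws) S_uniq map_inj_uniq;
  last exact: can_inj revK.
rewrite (perm_uniq ws) S_uniq andbT; apply/hasPn => w /mapP[v hv ->].
by rewrite (perm_mem ws); apply: rev_notin_S_list => //; rewrite -(perm_mem ws).
Qed.
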